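(* Let $\alpha\ge 1$ be an integer and let $a,b\in\mathbb{R}$. Consider, for real-valued functions $\varphi$ on $\mathbb{R}$, the stationary equation $$-\left(\frac{\varphi'}{1-\varphi^{2\alpha}}\right)'+\alpha\frac{(\varphi')^2}{(1-\varphi^{2\alpha})^2}\varphi^{2\alpha-1}-a\varphi^{2\alpha+1}+b\varphi=0 \quad\text{on } \mathbb{R}. \qquad (\ast)$$ (A) If $0<a\le(\alpha+1)b$, then $(\ast)$ has no non-trivial (i.e. not identically zero) solution $\varphi$ with $0\le\varphi<1$ and $\lim_{x\to\pm\infty}\varphi(x)=0$. (B) If $a>(\alpha+1)b>0$, then $(\ast)$ has a solution $\varphi$ with $0<\varphi<1$ on $\mathbb{R}$ that tends to $0$ at $\pm\infty$, and this solution is unique modulo translations. Up to translation it is given by $$\varphi(x)=\left(\frac12\left(\frac{a}{(\alpha+1)b}+1\right)+\frac12\left(\frac{a}{(\alpha+1)b}-1\right)\cosh\left(2\alpha\sqrt{b}\,x\right)\right)^{-\frac{1}{2\alpha}},\qquad x\in\mathbb{R}.$$ In particular, this function $\varphi$ satisfies: (i) $\varphi\in C^1(\mathbb{R})$; (ii) $\varphi(x)=\varphi(-x)$ for all $x\in\mathbb{R}$; (iii) $\varphi'(x)<0$ for all $x>0$; (iv) $\varphi(x)\sim C e^{-\sqrt{b}\,x}$ as $x\to+\infty$, for some constant $C>0$; (v) $\varphi$ is non-degenerate, i.e. $\ker L=\mathrm{span}\{\varphi'\}$ in $L^2(\mathbb{R})$, where $L$ is the linearized operator of $(\ast)$ at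 $\varphi$.
   Context: A solution of $(\ast)$ with $0\le\varphi<1$ is understood in the classical sense: $\varphi\in C^1(\mathbb{R})$ and $\chi:=\varphi'/(1-\varphi^{2\alpha})\in C^1(\mathbb{R})$, with $(\ast)$ holding pointwise. Equivalently, $(\chi,\varphi)$ is a $C^1$ solution on $\mathbb{R}$ of the first-order system $\chi'=\alpha\chi^2\varphi^{2\alpha-1}-a\varphi^{2\alpha+1}+b\varphi$, $\varphi'=\chi(1-\varphi^{2\alpha})$. The linearized operator $L$ at $\varphi$ is $$\begin{aligned}Lv=&-\left(\frac{v'}{1-\varphi^{2\alpha}}+\left(\frac{\varphi'}{1-\varphi^{2\alpha}}\right)\frac{2\alpha\varphi^{2\alpha-1}v}{1-\varphi^{2\alpha}}\right)'\\&+2\alpha\left(\frac{\varphi'}{1-\varphi^{2\alpha}}\right)\varphi^{2\alpha-1}\left(\frac{v'}{1-\varphi^{2\alpha}}+\left(\frac{\varphi'}{1-\varphi^{2\alpha}}\right)\frac{2\alpha\varphi^{2\alpha-1}v}{1-\varphi^{2\alpha}}\right)\\&+\alpha(2\alpha-1)\left(\frac{\varphi'}{1-\varphi^{2\alpha}}\right)^2\varphi^{2\alpha-2}v-a(2\alpha+1)\varphi^{2\alpha}v+bv,\end{aligned}$$ and $\ker L$ denotes the set of $v\in L^2(\mathbb{R})$ (real-valued) solving the linear second-order ODE $Lv=0$ on $\mathbb{R}$. The notation $f(x)\sim g(x)$ as $x\to+\infty$ means $f(x)/g(x)\to1$. *)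

(* Defs.v *)
From mathcomp Require Import all_boot all_order all_algebra.
From mathcomp Require Import all_classical all_reals all_analysis.

Set Implicit Arguments.
Unset Strict Implicit.
Unset Printing Implicit Defensive.

Import Order.TTheory GRing.Theory Num.Theory.
Import numFieldNormedType.Exports.

Local Open Scope classical_set_scope.
Local Open Scope ring_scope.

(* [derive1] is a total operator (with junk values), so differentiability has
   to be required separately. *)
Definition C1 (R : realType) (f : R -> R) : Prop :=
  (forall x, derivable f x 1) /\ continuous (derive1 f).

Definition chi (R : realType) (alpha : nat) (phi : R -> R) (x : R) : R :=
  derive1 phi x / (1 - phi x ^+ (2 * alpha)).

Definition stationary (R : realType) (alpha : nat) (a b : R)
    (phi : R -> R) (x : R) : R :=
  - derive1 (chi alpha phi) x
  + alpha%:R * (derive1 phi x ^+ 2 / (1 - phi x ^+ (2 * alpha)) ^+ 2)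
      * phi x ^+ (2 * alpha - 1)
  - a * phi x ^+ (2 * alpha + 1) + b * phi x.

Definition classical_solution (R : realType) (alpha : nat) (a b : R)
    (phi : R -> R) : Prop :=
  [/\ C1 phi, C1 (chi alpha phi) & forall x, stationary alpha a b phi x = 0].

Definition vanishes_at_infinity (R : realType) (f : R -> R) : Prop :=
  (f x @[x --> +oo] --> (0 : R)) /\ (f x @[x --> -oo] --> (0 : R)).

Definition solitary_wave (R : realType) (alpha : nat) (a b : R)
    (phi : R -> R) : Prop :=
  [/\ classical_solution alpha a b phi,
      forall x, 0 < phi x < 1
    & vanishes_at_infinity phi].

Definition cosh (R : realType) (x : R) : R := (expR x + expR (- x)) / 2.

Definition profile (R : realType) (alpha : nat) (a b : R) (x : R) : R :=
  (2^-1 * (a / ((alpha%:R + 1) * b) + 1)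
   + 2^-1 * (a / ((alpha%:R + 1) * b) - 1)
       * cosh (2 * alpha%:R * Num.sqrt b * x))
  `^ (- (2 * alpha%:R)^-1).

(* The linearization of [chi alpha] at [phi] in the direction [v]; it is the flux
   that occurs twice in the linearized operator. *)
Definition dchi (R : realType) (alpha : nat) (phi v : R -> R) (x : R) : R :=
  derive1 v x / (1 - phi x ^+ (2 * alpha))
  + chi alpha phi x
      * (2 * alpha%:R * phi x ^+ (2 * alpha - 1) * v x
         / (1 - phi x ^+ (2 * alpha))).

Definition linearized (R : realType) (alpha : nat) (a b : R)
    (phi v : R -> R) (x : R) : R :=
  - derive1 (dchi alpha phi v) x
  + 2 * alpha%:R * chi alpha phi x * phi x ^+ (2 * alpha - 1)
      * dchi alpha phi v x
  + alpha%:R * (2 * alpha%:R - 1) * chi alpha phi x ^+ 2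
      * phi x ^+ (2 * alpha - 2) * v x
  - a * (2 * alpha%:R + 1) * phi x ^+ (2 * alpha) * v x
  + b * v x.

(* Elements are genuine functions rather than a.e.-classes: a classical solution
   of the ODE is the unique continuous representative of its class. *)
Definition ker_linearized (R : realType) (alpha : nat) (a b : R)
    (phi : R -> R) : set (R -> R) :=
  [set v : R -> R | [/\ v \in Lfun (@lebesgue_measure R) 2%:E,
                    C1 v, C1 (dchi alpha phi v)
                  & forall x, linearized alpha a b phi v x = 0]].

Definition span1 (R : realType) (f : R -> R) : set (R -> R) :=
  [set v : R -> R | exists c : R, v = (fun x => c * f x)].

(* Main.v *)
Require Import Defs.
From mathcomp Require Import all_boot all_order all_algebra.
From mathcomp Require Import all_classical all_reals all_analysis.
From mathcomp Require Import measurable_realfun ring lra zify.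

(** Write [w = 1 - phi ^ (2 alpha)], [chi = phi' / w] and [kappa = a / (alpha + 1)].

   The stationary equation is equivalent to a first-order system for [(phi, chi)]
   which has a conserved energy, [chi^2 w - b phi^2 + kappa phi ^ (2 alpha + 2)]
   ([energy_cst]).  Decay of [phi] at infinity forces the energy to vanish: it is
   also the limit of [phi' ^2], and the derivative of a function with a limit cannot
   stay away from zero.  Hence ([first_integral])
     [chi^2 w = phi^2 (b - kappa phi ^ (2 alpha))].

   Nonexistence for [kappa <= b]: a nontrivial decaying [phi >= 0] has a positive
   maximum, where the left side vanishes while the right side is positive
   ([no_solitary_wave]).

   Uniqueness for [kappa > b > 0]: the substitution [u = phi ^ (- 2 alpha)] makes the
   equation linear, [u'' = k^2 (u - p)] with [k = 2 alpha sqrt b] and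
   [p = (kappa / b + 1) / 2].  At the maximum of [phi] one has [u' = 0] and, by the
   first integral, [u = kappa / b]; so [u] is a translate of
   [p + (kappa / b - 1) / 2 * cosh (k x)] ([wave_inverse_power]).  Running the same
   computation backwards shows that the profile is a solution ([profile_system]), and
   its parity, monotonicity and decay can be read off [u].

   Kernel of the linearized operator: [L v = 0] is a planar linear system for [v] and
   its flux [e] ([linear_system]), with trace zero, so Wronskians of two solutions are
   constant.  The pair [(phi', chi')] is a nowhere vanishing solution.  If its
   Wronskian with [(v, e)] vanishes then [v] is a multiple of [phi']
   ([wronskian0_proportional]).  Otherwise [(v / phi')'] is comparable to [1 / phi^2],
   so [v^2] stays above a positive constant near [+oo]
   ([positive_wronskian_growth]) and [v] is not square integrable.  Finally [phi'] is
   square integrable because it is bounded and [phi] is monotone and bounded on each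
   half line ([L2_derivative]). *)

Set Implicit Arguments.
Unset Strict Implicit.
Unset Printing Implicit Defensive.

Import Order.TTheory GRing.Theory Num.Theory.
Import numFieldNormedType.Exports.

Local Open Scope classical_set_scope.
Local Open Scope ring_scope.

(** * Calculus *)

(** A plain predicate for real functions, convertible to the class [is_derive]: the
   rules below are then applied by syntax alone, without instance resolution choosing
   another form of the derivative. *)
Definition has_deriv (R : realType) (f : R -> R) (x d : R) : Prop :=
  is_derive x (1 : R) f d.

Section Calculus.
Context {R : realType}.
Implicit Types (f g : R -> R) (x d : R).

Lemma has_derivD f g x d e : has_deriv f x d -> has_deriv g x e ->
  has_deriv (fun y => f y + g y) x (d + e).
Proof. exact: is_deriveD. Qed.

Lemma has_derivN f x d : has_deriv f x d -> has_deriv (fun y => - f y) x (- d).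
Proof. exact: is_deriveN. Qed.

Lemma has_derivM f g x d e : has_deriv f x d -> has_deriv g x e ->
  has_deriv (fun y => f y * g y) x (f x * e + g x * d).
Proof. exact: is_deriveM. Qed.

Lemma has_derivX f n x d : has_deriv f x d ->
  has_deriv (fun y => f y ^+ n) x (n%:R * f x ^+ n.-1 * d).
Proof.
move=> h; have := is_deriveX n h.
by rewrite (_ : f ^+ n = fun y => f y ^+ n) // funeqE => y; rewrite fctE.
Qed.

Lemma has_derivV f x d : f x != 0 -> has_deriv f x d ->
  has_deriv (fun y => (f y)^-1) x (- (f x ^- 2) * d).
Proof. exact: is_deriveV. Qed.

Lemma has_deriv_cst (k : R) x : has_deriv (fun=> k) x 0.
Proof. exact: is_derive_cst. Qed.

Lemma has_deriv_id x : has_deriv (fun y => y) x 1.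
Proof. exact: is_derive_id. Qed.

Lemma has_deriv_expR f x d : has_deriv f x d ->
  has_deriv (fun y => expR (f y)) x (expR (f x) * d).
Proof. by move=> h; exact: (@is_derive1_comp _ expR f). Qed.

Lemma has_deriv_eq f x d e : has_deriv f x d -> d = e -> has_deriv f x e.
Proof. by move=> h <-. Qed.

Lemma has_deriv_derive1 f x d : has_deriv f x d -> derive1 f x = d.
Proof. by move=> h; rewrite derive1E (@derive_val _ _ _ _ _ _ _ h). Qed.

Lemma has_deriv_self f x d : has_deriv f x d -> has_deriv f x (derive1 f x).
Proof. by move=> h; rewrite (has_deriv_derive1 h). Qed.

Lemma derivable_has_deriv f x : derivable f x 1 -> has_deriv f x (derive1 f x).
Proof. by move=> h; rewrite derive1E; exact: derivableP. Qed.

Lemma has_deriv_continuous f (df : R -> R) :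
  (forall x, has_deriv f x (df x)) -> continuous f.
Proof.
move=> h x; apply: differentiable_continuous; apply/derivable1_diffP.
by case: (h x).
Qed.

Lemma has_deriv_unique f x d e : has_deriv f x d -> has_deriv f x e -> d = e.
Proof. by move=> /has_deriv_derive1 <- /has_deriv_derive1 <-. Qed.

Lemma has_deriv0_cst f x y : (forall z, has_deriv f z 0) -> f x = f y.
Proof. exact: is_derive_0_is_cst. Qed.

End Calculus.

Section Powers.
Context {R : realType} (alpha : nat).
Hypothesis halpha : (1 <= alpha)%N.
Implicit Types z x : R.

(** Every exponent of the equation is reduced to a monomial in [z] times the common
   factor [z ^+ (2 * alpha - 2)], which [ring] and [field] then treat as an atom. *)
Lemma pow2a z : z ^+ (2 * alpha) = z ^+ (2 * alpha - 2) * z ^+ 2.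
Proof. by rewrite -exprD; congr (_ ^+ _); lia. Qed.

Lemma pow2a_pred z : z ^+ (2 * alpha - 1) = z ^+ (2 * alpha - 2) * z.
Proof. by rewrite -exprSr; congr (_ ^+ _); lia. Qed.

Lemma pow2a_succ z : z ^+ (2 * alpha + 1) = z ^+ (2 * alpha - 2) * z ^+ 3.
Proof. by rewrite -exprD; congr (_ ^+ _); lia. Qed.

Lemma pow2a_succ2 z : z ^+ (2 * alpha + 2) = z ^+ (2 * alpha - 2) * z ^+ 4.
Proof. by rewrite -exprD; congr (_ ^+ _); lia. Qed.

Definition pow2aE := (pow2a_pred, pow2a_succ, pow2a_succ2, pow2a).

Lemma has_deriv_pow2a (f : R -> R) x d : has_deriv f x d ->
  has_deriv (fun y => f y ^+ (2 * alpha)) x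
    (2 * alpha%:R * f x ^+ (2 * alpha - 1) * d).
Proof.
move=> h; apply: (has_deriv_eq (has_derivX _ h)).
by rewrite natrM; congr (_ * f x ^+ _ * _); lia.
Qed.

Lemma has_deriv_pow2a_pred (f : R -> R) x d : has_deriv f x d ->
  has_deriv (fun y => f y ^+ (2 * alpha - 1)) x
    ((2 * alpha%:R - 1) * f x ^+ (2 * alpha - 2) * d).
Proof.
move=> h; apply: (has_deriv_eq (has_derivX _ h)).
rewrite natrB; last by lia.
by rewrite natrM; congr (_ * f x ^+ _ * _); lia.
Qed.

Lemma has_deriv_pow2a_succ (f : R -> R) x d : has_deriv f x d ->
  has_deriv (fun y => f y ^+ (2 * alpha + 1)) x
    ((2 * alpha%:R + 1) * f x ^+ (2 * alpha) * d).
Proof.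
move=> h; apply: (has_deriv_eq (has_derivX _ h)).
rewrite natrD natrM; congr (_ * f x ^+ _ * _); lia.
Qed.

Lemma has_deriv_pow2a_succ2 (f : R -> R) x d : has_deriv f x d ->
  has_deriv (fun y => f y ^+ (2 * alpha + 2)) x
    ((2 * alpha%:R + 2) * f x ^+ (2 * alpha + 1) * d).
Proof.
move=> h; apply: (has_deriv_eq (has_derivX _ h)).
rewrite natrD natrM; congr (_ * f x ^+ _ * _); lia.
Qed.

Lemma pow2a_lt1 z : 0 <= z < 1 -> z ^+ (2 * alpha) < 1.
Proof. by move=> /andP[z0 z1]; rewrite exprn_ilt1// -lt0n; lia. Qed.

End Powers.

(** [deriv_step] applies one differentiation rule, or a hypothesis that gives the
   derivative; the rules for the powers with exponent near [2 * alpha] come before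
   the generic one, since their derivatives keep an exponent of the same shape.
   [deriv] leaves the equality between the derivative so found and the expected one. *)
Ltac deriv_step := first
  [ match goal with h : _ |- _ => exact: h end
  | apply: has_deriv_cst | apply: has_deriv_id
  | apply: has_derivD | apply: has_derivN | apply: has_derivM
  | apply: has_deriv_pow2a_succ2 => // | apply: has_deriv_pow2a_succ => //
  | apply: has_deriv_pow2a_pred => // | apply: has_deriv_pow2a => //
  | apply: has_derivX | apply: has_derivV | apply: has_deriv_expR ].
Ltac deriv := eapply has_deriv_eq; [repeat deriv_step | cbv beta].

Section ScalarODE.
Context {R : realType}.
Implicit Types (f g df : R -> R) (x y z : R).

Lemma C1_intro f df : (forall x, has_deriv f x (df x)) -> continuous df -> C1 f.
Proof.
move=> h c; split; first by move=> x; case: (h x).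
by rewrite (_ : derive1 f = df)// funeqE => x; apply: has_deriv_derive1.
Qed.

(** [f * expR (- k x)] has zero derivative. *)
Lemma exp_ode f (k x0 x : R) : (forall y, has_deriv f y (k * f y)) ->
  f x = f x0 * expR (k * (x - x0)).
Proof.
move=> h.
have : f x * expR (- (k * x)) = f x0 * expR (- (k * x0)).
  apply: (@has_deriv0_cst _ (fun y => f y * expR (- (k * y)))) => y.
  by deriv; ring.
rewrite !expRN => /(congr1 (fun z => z * expR (k * x))).
rewrite mulfVK ?gt_eqF ?expR_gt0// => ->.
by rewrite -expRN -mulrA -expRD; congr (_ * expR _); ring.
Qed.

(** The combinations [f' + k f] and [f' - k f] both solve a first-order equation. *)
Lemma cosh_ode f g (k x0 x : R) : k != 0 -> (forall y, has_deriv f y (g y)) ->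
  (forall y, has_deriv g y (k ^+ 2 * f y)) -> g x0 = 0 ->
  f x = f x0 * cosh (k * (x - x0)).
Proof.
move=> k0 hf hg g0.
have h1 := @exp_ode (fun y => g y + k * f y) k x0 x.
have h2 := @exp_ode (fun y => g y - k * f y) (- k) x0 x.
have {}h1 := h1 ltac:(by move=> y; deriv; ring).
have {}h2 := h2 ltac:(by move=> y; deriv; ring).
rewrite g0 in h1 h2; rewrite /cosh -mulNr.
apply: (mulfI k0).
have -> : k * f x = ((g x + k * f x) - (g x - k * f x)) / 2 by field.
by rewrite h1 h2; field.
Qed.

Lemma has_deriv_ge0_le f df x y : x <= y ->
  (forall z, x <= z -> has_deriv f z (df z)) ->
  (forall z, x <= z -> 0 <= df z) -> f x <= f y.
Proof.
move=> xy h pos.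
have [z zxy||c cxy e] := @MVT_segment _ f df x y xy.
- by apply: h; rewrite (itvP zxy).
- apply: derivable_within_continuous => z zxy.
  by case: (h z) => //; rewrite (itvP zxy).
- by rewrite -subr_ge0 e mulr_ge0 ?subr_ge0// pos// (itvP cxy).
Qed.

Lemma cvg_pow0 f n : (0 < n)%N -> f x @[x --> +oo] --> (0 : R) ->
  f x ^+ n @[x --> +oo] --> (0 : R).
Proof.
move=> n0 f0; have -> : 0 = 0 ^+ n :> R by rewrite expr0n eqn0Ngt n0.
by apply: (cvg_comp _ (fun z : R => z ^+ n)) f0 _; exact: exprn_continuous.
Qed.

(** On intervals of length one the mean value theorem gives points, arbitrarily far
   away, where the derivative is an increment of [f], hence small. *)
Lemma limit_deriv_sqr_eq0 f df (e : R) : (forall x, has_deriv f x (df x)) ->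
  f x @[x --> +oo] --> (0 : R) -> df x ^+ 2 @[x --> +oo] --> e -> e = 0.
Proof.
move=> h f0 dfe; apply/eqP/negPn/negP => e0.
have e2 : 0 < `|e| / 2 by rewrite divr_gt0// normr_gt0.
have f1 : (f (x + 1) - f x) ^+ 2 @[x --> +oo] --> (0 : R).
  apply: cvg_pow0 => //; rewrite -[X in _ `=>` nbhs X](subrr 0).
  apply: cvgB => //.
  by apply: cvg_comp f0; exact: cvg_addrr.
move/cvgrPdist_lt: f1 => /(_ _ e2).
move/cvgrPdist_lt: dfe => /(_ _ e2) [M [_ hM]] [N [_ hN]].
pose m := Num.max M N + 1.
have mM : M < m by rewrite ltr_pwDr// le_max lexx.
have mN : N < m by rewrite ltr_pwDr// le_max lexx orbT.
have := hN m mN; rewrite sub0r normrN /=.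
have [|||c cm ->] := @MVT _ f df m (m + 1); first by rewrite ltrDl.
- by move=> x _; exact: h.
- by apply: continuous_subspaceT; exact: has_deriv_continuous h.
have := hM c (lt_trans mM _); rewrite (itvP cm) => /(_ isT) h1.
rewrite addrAC subrr add0r mulr1 => h2.
have : `|e| < `|e|.
  rewrite {1}(_ : e = (e - df c ^+ 2) + df c ^+ 2); last by ring.
  by rewrite (le_lt_trans (ler_normD _ _))// [X in _ < X]splitr ltrD.
by rewrite ltxx.
Qed.

(** Far enough to the left and to the right [f] is below [f x0], so that its maximum
   on a large segment lies in the interior. *)
Lemma exists_critical_point f df (x0 : R) : (forall x, has_deriv f x (df x)) ->
  vanishes_at_infinity f -> 0 < f x0 -> exists2 x1, df x1 = 0 & f x0 <= f x1.
Proof.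
move=> h [/cvgrPdist_lt/(_ _)/= fp /cvgrPdist_lt/(_ _)/= fm] f0.
have [M [_ hM]] := fp _ f0; have [N [_ hN]] := fm _ f0.
pose A := Num.min N x0 - 1; pose B := Num.max M x0 + 1.
have AN : A < N by rewrite ltrBlDr ltr_pwDr// ge_min lexx.
have Ax : A < x0 by rewrite ltrBlDr ltr_pwDr// ge_min lexx orbT.
have BM : M < B by rewrite ltr_pwDr// le_max lexx.
have Bx : x0 < B by rewrite ltr_pwDr// le_max lexx orbT.
have [|c cAB fc] := EVT_max (ltW (lt_trans Ax Bx)) (f := f).
  by apply: continuous_subspaceT; exact: has_deriv_continuous h.
have fc0 : f x0 <= f c by apply: fc; rewrite in_itv /= !ltW.
exists c => //.
have fA : f A < f x0.
  by have := hN A AN; rewrite sub0r normrN; apply: le_lt_trans; exact: ler_norm.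
have fB : f B < f x0.
  by have := hM B BM; rewrite sub0r normrN; apply: le_lt_trans; exact: ler_norm.
apply: (has_deriv_unique (h c)).
apply: (@derive1_at_max _ f A B).
- exact: ltW (lt_trans Ax Bx).
- by move=> t _; case: (h t).
- rewrite in_itv /= !lt_neqAle !(itvP cAB) !andbT; apply/andP; split; apply/eqP => E.
    by move: fc0; rewrite -E leNgt fA.
  by move: fc0; rewrite E leNgt fB.
- by move=> t; rewrite in_itv /= => /andP[t1 t2]; apply: fc; rewrite in_itv /= !ltW.
Qed.

End ScalarODE.

(** * The stationary system and its energy *)

(** The equation solved for [(phi', chi')], with [c] standing for [chi]; it makes sense
   without dividing by [1 - phi ^+ (2 * alpha)]. *)
Definition stationary_system (R : realType) (alpha : nat) (a b : R)
    (phi c : R -> R) : Prop :=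
  (forall x, has_deriv phi x (c x * (1 - phi x ^+ (2 * alpha)))) /\
  (forall x, has_deriv c x (alpha%:R * c x ^+ 2 * phi x ^+ (2 * alpha - 1)
     - a * phi x ^+ (2 * alpha + 1) + b * phi x)).

Section System.
Context {R : realType} (alpha : nat) (a b : R).
Hypothesis halpha : (1 <= alpha)%N.
Implicit Types (phi c : R -> R).

Lemma classical_solution_system phi :
  (forall x, phi x ^+ (2 * alpha) != 1) -> classical_solution alpha a b phi ->
  stationary_system alpha a b phi (chi alpha phi).
Proof.
move=> w1 [[dphi _] [dchi _] eq0]; split=> x.
  apply: (has_deriv_eq (derivable_has_deriv (dphi x))).
  by rewrite /chi divfK// subr_eq0 eq_sym.
apply: (has_deriv_eq (derivable_has_deriv (dchi x))).
have := eq0 x; rewrite /stationary /chi expr_div_n => /eqP.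
by rewrite -!addrA addrC subr_eq0 eq_sym => /eqP ->; ring.
Qed.

Lemma system_chi phi c : (forall x, phi x ^+ (2 * alpha) != 1) ->
  stationary_system alpha a b phi c -> chi alpha phi = c.
Proof.
move=> w1 [h _]; rewrite funeqE => x.
by rewrite /chi (has_deriv_derive1 (h x)) mulfK// subr_eq0 eq_sym.
Qed.

Lemma system_classical_solution phi c :
  (forall x, phi x ^+ (2 * alpha) != 1) ->
  stationary_system alpha a b phi c -> classical_solution alpha a b phi.
Proof.
move=> w1 S; have E := system_chi w1 S; case: (S) => hphi hc.
split; rewrite ?E.
- apply: (C1_intro hphi); apply: has_deriv_continuous => x.
  by deriv_step; [deriv_step | deriv_step; [deriv_step|deriv_step; deriv_step]].
- apply: (C1_intro hc); apply: has_deriv_continuous => x.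
  by repeat deriv_step.
- move=> x; rewrite /stationary E (has_deriv_derive1 (hc x)) -expr_div_n.
  by rewrite -[_ / _]/(chi alpha phi x) E; ring.
Qed.

(** The equation is the Euler-Lagrange equation of an autonomous Lagrangian; this is
   twice its Hamiltonian. *)
Lemma energy_cst phi c x y : stationary_system alpha a b phi c ->
  c x ^+ 2 * (1 - phi x ^+ (2 * alpha))
    - b * phi x ^+ 2 + a / (alpha%:R + 1) * phi x ^+ (2 * alpha + 2) =
  c y ^+ 2 * (1 - phi y ^+ (2 * alpha))
    - b * phi y ^+ 2 + a / (alpha%:R + 1) * phi y ^+ (2 * alpha + 2).
Proof.
move=> [hphi hc].
apply: (@has_deriv0_cst _ (fun x => c x ^+ 2 * (1 - phi x ^+ (2 * alpha))
    - b * phi x ^+ 2 + a / (alpha%:R + 1) * phi x ^+ (2 * alpha + 2))) => z.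
deriv; rewrite !pow2aE//; field.
by rewrite natr1 pnatr_eq0.
Qed.

(** The energy vanishes for decaying solutions: since [phi] tends to 0, the energy is
   the limit of [phi' ^2], which can only be 0. *)
Lemma first_integral phi c x : (forall x, 0 <= phi x < 1) ->
  vanishes_at_infinity phi -> stationary_system alpha a b phi c ->
  c x ^+ 2 * (1 - phi x ^+ (2 * alpha)) =
  phi x ^+ 2 * (b - a / (alpha%:R + 1) * phi x ^+ (2 * alpha)).
Proof.
move=> phi01 [phip phim] S.
pose e := c x ^+ 2 * (1 - phi x ^+ (2 * alpha))
    - b * phi x ^+ 2 + a / (alpha%:R + 1) * phi x ^+ (2 * alpha + 2).
have pw n n0 := @cvg_pow0 _ phi n n0 phip.
suff e0 : e = 0.
  by apply/eqP; rewrite -subr_eq0 -e0 /e; apply/eqP; rewrite !pow2aE//; ring.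
apply: (limit_deriv_sqr_eq0 S.1 phip).
have -> : (fun y => (c y * (1 - phi y ^+ (2 * alpha))) ^+ 2) =
  fun y => (e + b * phi y ^+ 2 - a / (alpha%:R + 1) * phi y ^+ (2 * alpha + 2))
           * (1 - phi y ^+ (2 * alpha)).
  by rewrite funeqE => y; rewrite /e (energy_cst x y S); ring.
set F := (X in X @ _ --> _).
have -> : e = (e + b * 0 - a / (alpha%:R + 1) * 0) * (1 - 0) by ring.
rewrite {}/F.
apply: cvgM; last by apply: cvgB; [exact: cvg_cst|apply: pw; lia].
apply: cvgB; last by apply: cvgM; [exact: cvg_cst|apply: pw; lia].
by apply: cvgD; [exact: cvg_cst|apply: cvgM; [exact: cvg_cst|apply: pw; lia]].
Qed.

Lemma derive1_sqr phi c x : (forall x, 0 <= phi x < 1) ->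
  vanishes_at_infinity phi -> stationary_system alpha a b phi c ->
  derive1 phi x ^+ 2 = (1 - phi x ^+ (2 * alpha)) * phi x ^+ 2
    * (b - a / (alpha%:R + 1) * phi x ^+ (2 * alpha)).
Proof.
move=> phi01 phi0 S; rewrite (has_deriv_derive1 (S.1 x)) exprMn expr2 mulrACA -expr2.
transitivity (c x ^+ 2 * (1 - phi x ^+ (2 * alpha)) * (1 - phi x ^+ (2 * alpha))).
  by ring.
by rewrite (first_integral x phi01 phi0 S); ring.
Qed.

End System.

(** At a positive maximum [phi' = 0] makes one side of the first integral vanish,
   while [a / (alpha + 1) <= b] and [phi < 1] make the other one positive. *)
Lemma no_solitary_wave (R : realType) (alpha : nat) (a b : R) (phi : R -> R) (x0 : R) :
  (1 <= alpha)%N -> 0 < a -> a <= (alpha%:R + 1) * b ->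
  classical_solution alpha a b phi -> (forall x, 0 <= phi x < 1) ->
  vanishes_at_infinity phi -> phi x0 = 0.
Proof.
move=> halpha a0 ab sol phi01 phi0.
have w1 x : phi x ^+ (2 * alpha) != 1 by rewrite lt_eqF// pow2a_lt1.
have S := classical_solution_system w1 sol.
apply/eqP; apply: contraT => nz.
have px0 : 0 < phi x0 by rewrite lt_neqAle eq_sym nz; case/andP: (phi01 x0).
have [x1 c0 px1] := exists_critical_point S.1 phi0 px0.
have {}px1 : 0 < phi x1 by exact: lt_le_trans px1.
have := first_integral halpha x1 phi01 phi0 S.
move/eqP: c0; rewrite mulf_eq0 subr_eq0 (eq_sym 1) (negbTE (w1 x1)) orbF => /eqP ->.
move=> /esym/eqP; rewrite expr0n mul0r mulf_eq0 expf_eq0 (gt_eqF px1) /=.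
rewrite subr_eq0 gt_eqF//.
have k0 : 0 < alpha%:R + 1 :> R by rewrite natr1 ltr0n.
rewrite mulrAC ltr_pdivrMr// (lt_le_trans _ (_ : a <= _))//; last by rewrite mulrC.
by rewrite gtr_pMr// pow2a_lt1.
Qed.

(** * The explicit profile *)

(** The value at the origin of [phi ^ (- 2 alpha)] for the profile [phi]; for [b > 0] it
   exceeds 1 exactly when [(alpha + 1) * b < a]. *)
Definition coupling (R : realType) (alpha : nat) (a b : R) : R :=
  a / ((alpha%:R + 1) * b).

Definition rate (R : realType) (alpha : nat) (b : R) : R :=
  2 * alpha%:R * Num.sqrt b.

(** The profile raised to the power [- 2 alpha]. *)
Definition profile_base (R : realType) (alpha : nat) (a b x : R) : R :=
  2^-1 * (coupling alpha a b + 1)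
  + 2^-1 * (coupling alpha a b - 1) * cosh (rate alpha b * x).

(** The derivative of [profile_base]. *)
Definition profile_base' (R : realType) (alpha : nat) (a b x : R) : R :=
  2^-1 * (coupling alpha a b - 1) * rate alpha b
    * ((expR (rate alpha b * x) - expR (- (rate alpha b * x))) / 2).

Section Profile.
Context {R : realType} (alpha : nat) (a b : R).
Hypothesis halpha : (1 <= alpha)%N.
Hypothesis hb : 0 < (alpha%:R + 1) * b.
Hypothesis hab : (alpha%:R + 1) * b < a.
Implicit Types (psi c : R -> R) (x y : R).

Local Notation r := (coupling alpha a b).
Local Notation k := (rate alpha b).
Local Notation U := (profile_base alpha a b).
Local Notation S := (profile_base' alpha a b).
Local Notation phi := (profile alpha a b).
Local Notation W psi x := (psi x ^+ (2 * alpha)).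

Lemma alpha1_gt0 : 0 < alpha%:R + 1 :> R.
Proof. by rewrite natr1 ltr0n. Qed.

Lemma alpha_gt0 : 0 < alpha%:R :> R.
Proof. by rewrite ltr0n. Qed.

Lemma b_gt0 : 0 < b.
Proof. by move: hb; rewrite pmulr_rgt0// alpha1_gt0. Qed.

Lemma coupling_gt1 : 1 < r.
Proof. by rewrite /coupling ltr_pdivlMr// mul1r. Qed.

Lemma couplingE : a = r * ((alpha%:R + 1) * b).
Proof. by rewrite /coupling divfK// gt_eqF. Qed.

Lemma couplingbE : a / (alpha%:R + 1) = r * b.
Proof. by rewrite /coupling; field; rewrite !gt_eqF ?b_gt0 ?alpha1_gt0. Qed.

Lemma rate_sqr : k ^+ 2 = 4 * alpha%:R ^+ 2 * b.
Proof. by rewrite /rate exprMn sqr_sqrtr ?ltW ?b_gt0//; ring. Qed.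

Lemma rate_gt0 : 0 < k.
Proof. by rewrite /rate !mulr_gt0 ?alpha_gt0// sqrtr_gt0 b_gt0. Qed.

(** Along the zero energy level, [u = phi ^ (- 2 alpha)] satisfies a linear equation
   with constant coefficients; its initial data are taken at a maximum of [phi], where
   the first integral gives [u = coupling]. *)
Lemma wave_inverse_power psi : solitary_wave alpha a b psi ->
  exists t : R, forall x, (W psi x)^-1 = U (x - t).
Proof.
move=> [sol psi01 psi0].
have psi01' x : 0 <= psi x < 1 by case/andP: (psi01 x) => /ltW -> ->.
have w1 x : W psi x != 1 by rewrite lt_eqF// pow2a_lt1.
have Sys := classical_solution_system w1 sol.
have FI x := first_integral halpha x psi01' psi0 Sys.
case: (Sys) => hpsi hc; set c := chi alpha psi in Sys FI hpsi hc.
have ppos x : 0 < psi x by case/andP: (psi01 x).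
have p0 x : psi x != 0 by rewrite gt_eqF.
have q0 x : psi x ^+ (2 * alpha - 2) != 0 by rewrite expf_neq0.
have [x1 c1 _] := exists_critical_point hpsi psi0 (ppos 0).
move/eqP: c1; rewrite mulf_eq0 subr_eq0 (eq_sym 1) (negbTE (w1 x1)) orbF => /eqP c1.
pose u x := (W psi x)^-1 - 2^-1 * (r + 1).
pose s x := - 2 * alpha%:R * c x * (1 - W psi x) * (psi x * W psi x)^-1.
have hu x : has_deriv u x (s x).
  rewrite /u /s; deriv; first by rewrite expf_neq0.
  by rewrite !pow2aE//; field; rewrite p0 q0.
have hs x : has_deriv s x (k ^+ 2 * u x).
  rewrite /s; deriv; first by rewrite mulf_neq0 ?expf_neq0.
  (* The required identity is [M] times the first integral. *)
  pose M := - 2 * alpha%:R * (- alpha%:R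
    - (2 * alpha%:R + 1) * (1 - W psi x) / W psi x) / psi x ^+ 2.
  apply/eqP; rewrite -subr_eq0; apply/eqP.
  rewrite rate_sqr.
  transitivity (M * (c x ^+ 2 * (1 - W psi x)
    - psi x ^+ 2 * (b - a / (alpha%:R + 1) * W psi x))).
    rewrite couplingbE /M /u; move: couplingE; generalize r => r' ->.
    by rewrite !pow2aE//; field; rewrite p0 q0.
  by rewrite FI subrr mulr0.
have s1 : s x1 = 0 by rewrite /s c1 !(mulr0, mul0r).
have W1 : (W psi x1)^-1 = r.
  have := FI x1; rewrite c1 expr0n mul0r => /esym/eqP.
  rewrite mulf_eq0 expf_eq0 (negbTE (p0 x1)) /= couplingbE subr_eq0 => /eqP E.
  have Wn0 : W psi x1 != 0 by rewrite expf_neq0.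
  apply: (mulIf Wn0); rewrite mulVf//.
  by apply: (mulIf (lt0r_neq0 b_gt0)); rewrite mul1r mulrAC -E.
exists x1 => x.
have := @cosh_ode _ u s k x1 x (lt0r_neq0 rate_gt0) hu hs s1.
rewrite /u /profile_base W1 => /eqP; rewrite subr_eq => /eqP ->.
by rewrite addrC; congr (_ + _ * _); field.
Qed.

Lemma pow2a_powRK (z : R) : 0 < z ->
  (z ^+ (2 * alpha))^-1 `^ (- (2 * alpha%:R)^-1) = z.
Proof.
move=> z0; rewrite -powR_invn ?ltW// -powRrM natrM mulrNN mulfV ?powRr1 ?ltW//.
by rewrite gt_eqF// mulr_gt0 ?alpha_gt0.
Qed.

Lemma wave_translate psi : solitary_wave alpha a b psi ->
  exists t : R, forall x, psi x = phi (x - t).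
Proof.
move=> sw; have [t ht] := wave_inverse_power sw; exists t => x.
case: sw => _ psi01 _; have /andP[p0 _] := psi01 x.
by rewrite -[LHS]pow2a_powRK// ht.
Qed.

Lemma cosh_ge1 x : 1 <= cosh x.
Proof.
rewrite /cosh ler_pdivlMr// mul1r expRN -subr_ge0.
have e0 : 0 < expR x by exact: expR_gt0.
have -> : expR x + (expR x)^-1 - 2 = (expR x - 1) ^+ 2 / expR x.
  by field; rewrite gt_eqF.
by rewrite divr_ge0 ?sqr_ge0// ltW.
Qed.

Lemma profile_base_ge x : r <= U x.
Proof.
have := cosh_ge1 (k * x); have := coupling_gt1; rewrite /profile_base; nra.
Qed.

Lemma profile_base_gt1 x : 1 < U x.
Proof. exact: lt_le_trans coupling_gt1 (profile_base_ge x). Qed.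

Lemma profile_base_gt0 x : 0 < U x.
Proof. exact: lt_trans ltr01 (profile_base_gt1 x). Qed.

Lemma has_deriv_profile_base x : has_deriv U x (S x).
Proof. by rewrite /profile_base /profile_base' /cosh; deriv; ring. Qed.

Lemma has_deriv_profile_base' x :
  has_deriv S x (k ^+ 2 * (U x - 2^-1 * (r + 1))).
Proof. by rewrite /profile_base /profile_base' /cosh; deriv; ring. Qed.

(** The first integral expressed in terms of [u = phi ^ (- 2 alpha)]. *)
Lemma profile_base'_sqr x :
  S x ^+ 2 = k ^+ 2 * (U x - 1) * (U x - r).
Proof.
rewrite /profile_base /profile_base' /cosh expRN.
have := expR_gt0 (k * x); move: (expR _) => e e0.
by field; rewrite gt_eqF.
Qed.

Lemma profile_base'_gt0 x : 0 < x -> 0 < S x.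
Proof.
move=> x0; have d0 : 0 < expR (k * x) - expR (- (k * x)).
  by rewrite subr_gt0 ltr_expR gtrN// mulr_gt0 ?rate_gt0.
rewrite /profile_base' mulr_gt0 ?divr_gt0//.
by rewrite mulr_gt0 ?rate_gt0// mulr_gt0 ?invr_gt0// subr_gt0 coupling_gt1.
Qed.

Lemma profile_gt0 x : 0 < phi x.
Proof. by apply: powR_gt0; exact: profile_base_gt0. Qed.

Lemma profile_pow2a x : W phi x = (U x)^-1.
Proof.
have U0 := profile_base_gt0 x.
rewrite -powR_mulrn ?powR_ge0// /profile -powRrM natrM mulNr mulVf.
  by rewrite powR_inv1// ltW.
by rewrite gt_eqF// mulr_gt0 ?alpha_gt0.
Qed.

Lemma profile_lt1 x : phi x < 1.
Proof.
rewrite -(@expr_lt1 _ (2 * alpha)) ?ltW ?profile_gt0//; last by lia.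
by rewrite profile_pow2a invf_lt1 ?profile_base_gt1 ?profile_base_gt0.
Qed.

Lemma has_deriv_profile x :
  has_deriv phi x (- (2 * alpha%:R)^-1 * phi x * S x / U x).
Proof.
have U0 := profile_base_gt0 x.
have h := is_derive1_powR (- (2 * alpha%:R)^-1) U0.
have := @is_derive1_comp _ _ U x _ _ h (has_deriv_profile_base x).
move=> {}h; apply: (has_deriv_eq h).
rewrite powRB; last by rewrite (gt_eqF U0) implybT.
rewrite powRr1 ?ltW// -[U x `^ _]/(phi x).
by generalize (- (2 * alpha%:R : R)^-1) (phi x) (S x) (U x)^-1 => s p s1 u; ring.
Qed.

(** The second component of the system, [chi] along the profile. *)
Definition profile_chi x := - (2 * alpha%:R)^-1 * phi x * S x / (U x - 1).

(** Since [phi ^+ (2 * alpha) = U^-1], both equations divided by [phi] are rational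
   identities in [U] and [S] modulo the relation [profile_base'_sqr]. *)
Lemma profile_system : stationary_system alpha a b phi profile_chi.
Proof.
have U0 x : U x != 0 by rewrite gt_eqF ?profile_base_gt0.
have U1 x : U x - 1 != 0 by rewrite subr_eq0 gt_eqF ?profile_base_gt1.
have P0 x : phi x != 0 by rewrite gt_eqF ?profile_gt0.
have A0 : alpha%:R != 0 :> R by rewrite gt_eqF ?alpha_gt0.
have hphi := has_deriv_profile; have hU := has_deriv_profile_base.
have hS := has_deriv_profile_base'.
split=> x.
  apply: (has_deriv_eq (hphi x)); rewrite profile_pow2a /profile_chi.
  by field; rewrite U0 U1 A0.
rewrite /profile_chi; deriv.
have -> : phi x ^+ (2 * alpha - 1) = (U x * phi x)^-1.
  apply: (mulIf (P0 x)); rewrite -exprSr (_ : (2 * alpha - 1).+1 = 2 * alpha)%N; last by lia.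
  by rewrite profile_pow2a; field; rewrite U0 P0.
have -> : phi x ^+ (2 * alpha + 1) = phi x / U x.
  by rewrite addn1 exprS profile_pow2a.
(* The required identity is [M] times the relation between [S ^+ 2] and [U]. *)
pose s : R := - (2 * alpha%:R)^-1.
pose M := phi x * (- s / (U x - 1) ^+ 2 + s ^+ 2 / (U x * (U x - 1))
  - alpha%:R * s ^+ 2 / ((U x - 1) ^+ 2 * U x)).
apply/eqP; rewrite -subr_eq0; apply/eqP.
transitivity (M * (S x ^+ 2 - k ^+ 2 * (U x - 1) * (U x - r))).
  rewrite rate_sqr /M /s; move: (U0 x) (U1 x) (P0 x) couplingE.
  generalize (U x) (phi x) (S x) r => u p s' r' u0 u1 p0 ->.
  by field; rewrite u0 u1 A0 p0.
by rewrite profile_base'_sqr subrr mulr0.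
Qed.

Lemma profile_even x : phi x = phi (- x).
Proof. by rewrite /profile /cosh mulrN opprK (addrC (expR (- _))). Qed.

Lemma profile_decr x : 0 < x -> derive1 phi x < 0.
Proof.
move=> x0; rewrite (has_deriv_derive1 (has_deriv_profile x)) !mulNr oppr_lt0.
apply: divr_gt0; last exact: profile_base_gt0.
apply: mulr_gt0; last exact: profile_base'_gt0.
by rewrite mulr_gt0 ?profile_gt0// invr_gt0 mulr_gt0 ?alpha_gt0.
Qed.

End Profile.

(** * The linearized system *)

(** The equation [L v = 0] written for [v] and its flux [e = dchi v]; equivalently,
   the linearization of [stationary_system] at [(phi, c)]. *)
Definition linear_system (R : realType) (alpha : nat) (a b : R)
    (phi c v e : R -> R) : Prop :=
  (forall x, has_deriv v x (e x * (1 - phi x ^+ (2 * alpha))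
     - 2 * alpha%:R * c x * phi x ^+ (2 * alpha - 1) * v x)) /\
  (forall x, has_deriv e x
     (2 * alpha%:R * c x * phi x ^+ (2 * alpha - 1) * e x
      + alpha%:R * (2 * alpha%:R - 1) * c x ^+ 2
          * phi x ^+ (2 * alpha - 2) * v x
      - a * (2 * alpha%:R + 1) * phi x ^+ (2 * alpha) * v x + b * v x)).

Section Linear.
Context {R : realType} (alpha : nat) (a b : R).
Hypothesis halpha : (1 <= alpha)%N.
Variables (phi c : R -> R).
Hypothesis Sys : stationary_system alpha a b phi c.
Hypothesis phi_neq1 : forall x, phi x ^+ (2 * alpha) != 1.
Implicit Types (v e : R -> R) (x : R).

Lemma linearized_system v : C1 v -> C1 (dchi alpha phi v) ->
  (forall x, linearized alpha a b phi v x = 0) ->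
  linear_system alpha a b phi c v (dchi alpha phi v).
Proof.
have w0 x : 1 - phi x ^+ (2 * alpha) != 0 by rewrite subr_eq0 eq_sym.
have Ec := system_chi phi_neq1 Sys.
move=> [dv _] [de _] L; split=> x.
  apply: (has_deriv_eq (derivable_has_deriv (dv x))).
  by rewrite /dchi Ec; field; rewrite w0.
apply: (has_deriv_eq (derivable_has_deriv (de x))).
have := L x; rewrite /linearized Ec => /eqP.
by rewrite -!addrA addrC subr_eq0 eq_sym => /eqP ->; ring.
Qed.

Lemma system_linearized v e : linear_system alpha a b phi c v e ->
  [/\ C1 v, C1 (dchi alpha phi v) & forall x, linearized alpha a b phi v x = 0].
Proof.
have w0 x : 1 - phi x ^+ (2 * alpha) != 0 by rewrite subr_eq0 eq_sym.
have Ec := system_chi phi_neq1 Sys; have [hphi hc] := Sys.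
move=> [hv he].
have Ee : dchi alpha phi v = e.
  rewrite funeqE => x; rewrite /dchi Ec (has_deriv_derive1 (hv x)).
  by field; rewrite w0.
split.
- by apply: (C1_intro hv); apply: has_deriv_continuous => x; repeat deriv_step.
- rewrite Ee; apply: (C1_intro he); apply: has_deriv_continuous => x.
  by repeat deriv_step.
- by move=> x; rewrite /linearized Ec Ee (has_deriv_derive1 (he x)); ring.
Qed.

(** Translation invariance: differentiate [stationary_system] in [x]. *)
Lemma tangent_linear_system :
  linear_system alpha a b phi c (derive1 phi) (derive1 c).
Proof.
have [hphi hc] := Sys.
have -> : derive1 phi = fun x => c x * (1 - phi x ^+ (2 * alpha)).
  by rewrite funeqE => x; exact: has_deriv_derive1.
have -> : derive1 c = fun x => alpha%:R * c x ^+ 2 * phi x ^+ (2 * alpha - 1)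
     - a * phi x ^+ (2 * alpha + 1) + b * phi x.
  by rewrite funeqE => x; exact: has_deriv_derive1.
by split=> x; deriv; rewrite !pow2aE//; ring.
Qed.

Lemma linear_systemN v e : linear_system alpha a b phi c v e ->
  linear_system alpha a b phi c (fun x => - v x) (fun x => - e x).
Proof. by move=> [hv he]; split=> x; deriv; ring. Qed.

Lemma linear_systemZ k v e : linear_system alpha a b phi c v e ->
  linear_system alpha a b phi c (fun x => k * v x) (fun x => k * e x).
Proof. by move=> [hv he]; split=> x; deriv; ring. Qed.

(** The matrix of [linear_system] has trace zero. *)
Lemma wronskian_cst v1 e1 v2 e2 x y :
  linear_system alpha a b phi c v1 e1 -> linear_system alpha a b phi c v2 e2 ->
  v1 x * e2 x - v2 x * e1 x = v1 y * e2 y - v2 y * e1 y.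
Proof.
move=> [hv1 he1] [hv2 he2].
apply: (@has_deriv0_cst _ (fun x => v1 x * e2 x - v2 x * e1 x)) => z.
by deriv; ring.
Qed.

(** Collinear solutions differ by a scalar factor [k]; the equations give
   [k' v1 = k' e1 = 0], so [k] is constant where [(v1, e1)] does not vanish.  Writing
   [k] as a quotient by [v1^2 + e1^2] keeps it smooth across the zeros of [v1]. *)
Lemma wronskian0_proportional v1 e1 v2 e2 :
  linear_system alpha a b phi c v1 e1 -> linear_system alpha a b phi c v2 e2 ->
  (forall x, v1 x != 0 \/ e1 x != 0) ->
  (forall x, v1 x * e2 x - v2 x * e1 x = 0) ->
  exists k, forall x, v2 x = k * v1 x.
Proof.
move=> [hv1 he1] [hv2 he2] nz W0.
pose n x := v1 x ^+ 2 + e1 x ^+ 2.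
have n0 x : n x != 0.
  rewrite /n paddr_eq0 ?sqr_ge0// !expf_eq0 /=.
  by case: (nz x) => /negbTE ->; rewrite ?andbF.
pose k x := (v2 x * v1 x + e2 x * e1 x) / n x.
have W x : v2 x * e1 x = v1 x * e2 x by apply/eqP; rewrite eq_sym -subr_eq0 W0.
have kv x : v2 x = k x * v1 x.
  apply: (mulIf (n0 x)); rewrite /k mulrAC divfK//.
  by rewrite /n mulrDr mulrDl !expr2 !mulrA W; ring.
have ke x : e2 x = k x * e1 x.
  apply: (mulIf (n0 x)); rewrite /k mulrAC divfK//.
  by rewrite /n mulrDr mulrDl !expr2 -!mulrA -[v1 x * e1 x]mulrC !mulrA W; ring.
exists (k 0) => x; rewrite kv; congr (_ * _).
apply: has_deriv0_cst => {}x.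
rewrite /k; have hn := n0; rewrite /n in hn *; deriv.
move: (hn x); rewrite -/(n x) => hnx.
rewrite (kv x) (ke x) /n in hnx *; field.
exact: hnx.
Qed.

End Linear.

(** * Square integrability *)

Lemma not_L2_of_lower_bound (R : realType) (v : R -> R) (d : R) : 0 < d ->
  (\forall x \near +oo, d <= v x ^+ 2) ->
  v \in Lfun (@lebesgue_measure R) 2%:E -> False.
Proof.
move=> d0 /= vd.
have {vd}[M hM] : exists M : R, forall x, M < x -> d <= v x ^+ 2.
  by case: vd => M [_ hM]; exists M.
move=> /Lfun2_integrable_sqr/integrableP[mv].
pose mu := @lebesgue_measure R; pose D : set (measurableTypeR R) := `[M + 1, +oo[%classic.
pose g : measurableTypeR R -> \bar R := fun x => `|(v x ^+ 2)%:E|%E.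
rewrite -[integral _ _ _]/(\int[mu]_x g x)%E.
have muD : mu D = +oo%E by rewrite /mu /D lebesgue_measure_itv/= ltry.
have mD : measurable D by exact: measurable_itv.
have mg : measurable_fun setT g by exact: measurableT_comp.
suff -> : (\int[mu]_x g x)%E = +oo%E by [].
apply/eqP; rewrite eq_le leey /=.
apply: (@le_trans _ _ (\int[mu]_(x in D) g x)%E); last first.
  by apply: ge0_subset_integral => // x _; exact: abse_ge0.
apply: (@le_trans _ _ (\int[mu]_(x in D) cst d%:E x)%E).
  rewrite integral_cst// -[X in (_ * X)%E]/(mu D) muD.
  by rewrite gt0_muley// lte_fin.
apply: ge0_le_integral => //.
- by move=> x _; rewrite lee_fin ltW.
- exact: measurable_funS mg.
move=> x; rewrite /D /g /= in_itv /= andbT => Mx.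
rewrite lee_fin ger0_norm ?sqr_ge0//; apply: hM.
by rewrite (lt_le_trans _ Mx)// ltrDl.
Qed.

Lemma L2_of_integral_sqr (R : realType) (v : R -> R) : continuous v ->
  (\int[lebesgue_measure]_x (v x ^+ 2)%:E < +oo)%E ->
  v \in Lfun (@lebesgue_measure R) 2%:E.
Proof.
move=> cv iv; have mv := continuous_measurable_fun cv.
rewrite inE; apply/andP; split; rewrite inE//=.
rewrite /finite_norm unlock; apply: poweR_lty.
move: iv; congr (_ < _)%E; apply: eq_integral => x _ /=.
by rewrite powR_mulrn ?normr_ge0// -normrX ger0_norm// sqr_ge0.
Qed.

(** On the half line [x >= 0] one has [df^2 <= - K df], whose integral is [K * f 0];
   by oddness of [df] the other half line contributes as much. *)
Lemma L2_derivative (R : realType) (f df : R -> R) (K : R) :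
  (forall x, has_deriv f x (df x)) -> continuous df ->
  (forall x, 0 <= x -> df x <= 0) -> (forall x, - K <= df x) ->
  (forall x, df (- x) = - df x) ->
  f x @[x --> +oo] --> (0 : R) ->
  df \in Lfun (@lebesgue_measure R) 2%:E.
Proof.
move=> hf cdf df0 dfK odd f0.
apply: L2_of_integral_sqr => //.
have cdf2 : continuous (fun x => df x ^+ 2).
  move=> x; apply: (@continuous_comp _ _ _ df (fun y : R => y ^+ 2)).
    exact: cdf.
  exact: exprn_continuous.
rewrite ge0_symfun_integralT//; last 2 first.
- by move=> x; rewrite sqr_ge0.
- by move=> x /=; rewrite odd sqrrN.
have hF x : has_deriv (fun x => - K * f x) x (- K * df x).
  by apply: (has_deriv_eq (has_derivM (has_deriv_cst _ _) (hf x))); ring.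
have cF := has_deriv_continuous hF.
have K0 : 0 <= K by have := dfK 0; have := df0 0 (lexx _); lra.
have mdf2 : measurable_fun (setT : set R) (fun x => df x ^+ 2).
  exact: continuous_measurable_fun.
have cKdf : continuous (fun x => - K * df x).
  by move=> x; apply: cvgM; [exact: cvg_cst|exact: cdf].
have I : (\int[lebesgue_measure]_(x in `[0%R, +oo[) (- K * df x)%:E
          = 0%:E - (- K * f 0)%:E)%E.
  apply: (@ge0_continuous_FTC2y _ (fun x => - K * df x) (fun x => - K * f x)).
  - by move=> x x0; rewrite mulNr -mulrN mulr_ge0 // oppr_ge0 df0.
  - by apply: continuous_subspaceT.
  - have -> : 0 = - K * 0 :> R by rewrite mulr0.
    by apply: cvgM => //; exact: cvg_cst.
  - by move=> x _; case: (hF x).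
  - by apply: cvg_at_right_filter; exact: cF.
  - by move=> x _; rewrite (has_deriv_derive1 (hF x)).
rewrite -set_itvcy.
apply: lte_mul_pinfty => //.
apply: (@le_lt_trans _ _ (0%:E - (- K * f 0)%:E)%E); last by rewrite -EFinB ltry.
rewrite -I; apply: ge0_le_integral => //.
- by move=> x _; rewrite lee_fin sqr_ge0.
- by apply/measurable_EFinP; exact: measurable_funS mdf2.
- apply/measurable_EFinP; apply: (@measurable_funS _ _ _ _ setT) => //.
  exact: continuous_measurable_fun.
- move=> x; rewrite /= in_itv /= andbT => x0; rewrite lee_fin.
  by have := dfK x; have := df0 x x0; nra.
Qed.

(** * Growth of solutions transverse to the orbit *)

Section Growth.
Context {R : realType} (alpha : nat) (a b : R).
Hypothesis halpha : (1 <= alpha)%N.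
Variables (phi c : R -> R).
Hypothesis Sys : stationary_system alpha a b phi c.
Hypothesis phi01 : forall x, 0 < phi x < 1.
Hypothesis phi0 : vanishes_at_infinity phi.
Hypothesis a_ge0 : 0 <= a.
Hypothesis b_gt0 : 0 < b.
Hypothesis phi_decr : forall x, 0 < x -> derive1 phi x < 0.

(** The first integral bounds [phi' ^2] by [b], hence by [(1 + b)^2]. *)
Lemma derive1_ge x : - (1 + b) <= derive1 phi x.
Proof.
have phi01' y : 0 <= phi y < 1 by case/andP: (phi01 y) => /ltW -> ->.
have /andP[p0 p1] := phi01 x.
have W1 : phi x ^+ (2 * alpha) < 1 by rewrite pow2a_lt1.
have W0 : 0 < phi x ^+ (2 * alpha) by rewrite exprn_gt0.
have kap0 : 0 <= a / (alpha%:R + 1) by rewrite divr_ge0// addr_ge0// ler0n.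
have : derive1 phi x ^+ 2 <= b.
  rewrite (derive1_sqr halpha x phi01' phi0 Sys).
  have y0 : 0 <= (1 - phi x ^+ (2 * alpha)) * phi x ^+ 2.
    by rewrite mulr_ge0 ?sqr_ge0// subr_ge0 ltW.
  have y1 : (1 - phi x ^+ (2 * alpha)) * phi x ^+ 2 <= 1.
    rewrite mulr_ile1 ?sqr_ge0 ?subr_ge0 ?(ltW W1)//.
      by rewrite gerBl ltW.
    by rewrite exprn_ile1// ltW.
  apply: (@le_trans _ _ (1 * b)); last by rewrite mul1r.
  apply: (@le_trans _ _ ((1 - phi x ^+ (2 * alpha)) * phi x ^+ 2 * b)).
    by apply: ler_wpM2l => //; rewrite gerBl mulr_ge0// ltW.
  by apply: ler_wpM2r => //; exact: ltW.
by nra.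
Qed.

(** With [w] the Wronskian, [(v / phi')' = w / (phi^2 (b - kappa phi ^ (2 alpha)))] is at
   least [w / (b phi^2)], while the derivative of [1 / phi] is at most [(1 + b) / phi^2].
   Hence [v / phi'] grows at least like a multiple of [1 / phi]; since [phi' / phi] has a
   nonzero limit, [v] stays away from 0. *)
Lemma positive_wronskian_growth v e : linear_system alpha a b phi c v e ->
  0 < derive1 phi 0 * e 0 - v 0 * derive1 c 0 ->
  exists2 d : R, 0 < d & \forall x \near +oo, d <= v x ^+ 2.
Proof.
move=> L; set w := (X in 0 < X) => w0.
have phi01' x : 0 <= phi x < 1 by case/andP: (phi01 x) => /ltW -> ->.
have ppos x : 0 < phi x by case/andP: (phi01 x).
have p0 x : phi x != 0 by rewrite gt_eqF.
have W1 x : phi x ^+ (2 * alpha) < 1 by rewrite pow2a_lt1.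
have W0 x : 0 < phi x ^+ (2 * alpha) by rewrite exprn_gt0.
have T := tangent_linear_system halpha Sys.
have wE x : derive1 phi x * e x - v x * derive1 c x = w.
  exact: (wronskian_cst x 0 T L).
pose kap : R := a / (alpha%:R + 1).
have kap0 : 0 <= kap by rewrite divr_ge0// addr_ge0// ler0n.
pose B x := b - kap * phi x ^+ (2 * alpha).
have Bb x : B x <= b by rewrite /B gerBl mulr_ge0// ltW.
have sqE x : derive1 phi x ^+ 2 = (1 - phi x ^+ (2 * alpha)) * phi x ^+ 2 * B x.
  exact: (derive1_sqr halpha x phi01' phi0 Sys).
have Bpos x : 0 < x -> 0 < B x.
  move=> x0; have : 0 < derive1 phi x ^+ 2.
    by rewrite lt_neqAle sqr_ge0 andbT eq_sym expf_eq0 /= lt_eqF ?phi_decr.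
  by rewrite sqE pmulr_rgt0// mulr_gt0 ?exprn_gt0// subr_gt0.
(* The largest constant for which the two bounds make [g] below nondecreasing. *)
pose K := w / (b * (1 + b)).
have b1 : 0 < 1 + b by rewrite addr_gt0.
have K0 : 0 < K by rewrite divr_gt0// mulr_gt0.
have dphi_ge := derive1_ge.
pose g x := v x / derive1 phi x - K / phi x.
have dg x : 0 < x -> has_deriv g x (w * (1 - phi x ^+ (2 * alpha))
    / derive1 phi x ^+ 2 + K * derive1 phi x / phi x ^+ 2).
  move=> x0; have d0 : derive1 phi x != 0 by rewrite lt_eqF ?phi_decr.
  have hphi' := has_deriv_self (Sys.1 x).
  have [hv _] := L; have [hd _] := T; rewrite /g; deriv.
  rewrite -(wE x); move: d0 (p0 x).
  generalize (derive1 phi x) (derive1 c x) (phi x) => p q f p0' f0.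
  by field; rewrite p0' f0.
have g_incr x : 1 <= x -> g 1 <= g x.
  move=> x1; apply: (has_deriv_ge0_le x1) => y y1.
    by apply: dg; rewrite (lt_le_trans ltr01).
  have y0 : 0 < y by rewrite (lt_le_trans ltr01).
  have u0 : 1 - phi y ^+ (2 * alpha) != 0 by rewrite gt_eqF// subr_gt0.
  rewrite sqE (_ : _ + _ = (w / B y + K * derive1 phi y) / phi y ^+ 2); last first.
    by field; rewrite u0 p0 gt_eqF ?Bpos.
  rewrite divr_ge0 ?sqr_ge0//.
  have : w / b <= w / B y.
    by rewrite ler_pM2l// lef_pV2 ?posrE ?Bpos.
  have : w / b = K * (1 + b) by rewrite /K; field; rewrite !gt_eqF.
  by have := dphi_ge y; nra.
exists (K ^+ 2 / 4 * (b / 2)); first by rewrite mulr_gt0 ?divr_gt0 ?exprn_gt0.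
have pw n n0 := @cvg_pow0 _ phi n n0 phi0.1.
have Dphi : `|g 1| * phi x @[x --> +oo] --> (0 : R).
  have -> : 0 = `|g 1| * 0 :> R by rewrite mulr0.
  by apply: cvgM; [exact: cvg_cst|exact: phi0.1].
have wB : (1 - phi x ^+ (2 * alpha)) * B x @[x --> +oo] --> b.
  have -> : nbhs b = nbhs ((1 - 0) * (b - kap * 0)) by congr nbhs; ring.
  apply: cvgM; first by apply: cvgB; [exact: cvg_cst|apply: pw; lia].
  apply: cvgB; first exact: cvg_cst.
  by apply: cvgM; [exact: cvg_cst|apply: pw; lia].
near=> x.
have x1 : 1 <= x by near: x; apply: nbhs_pinfty_ge; exact: num_real.
have x0 : 0 < x by rewrite (lt_le_trans ltr01).
have D1 : `|g 1| * phi x <= K / 2.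
  by near: x; apply: (cvgr_le (0 : R)) => //; rewrite divr_gt0.
have B1 : b / 2 <= (1 - phi x ^+ (2 * alpha)) * B x.
  by near: x; apply: (cvgr_ge b) => //; rewrite gtr_pMr// invf_lt1// ltr1n.
(* [v] is [rho] times [phi' / phi], and [g x >= g 1] bounds [rho] from below. *)
pose rho := v x / derive1 phi x * phi x.
have rho1 : K / 2 <= rho.
  have -> : rho = g x * phi x + K by rewrite /rho /g; field; rewrite p0 lt_eqF ?phi_decr.
  have : - `|g 1| <= g x by rewrite (le_trans _ (g_incr x x1))// lerNl ler_normr lexx orbT.
  by move=> /(ler_wpM2r (ltW (ppos x))); lra.
have -> : v x ^+ 2 = rho ^+ 2 * ((1 - phi x ^+ (2 * alpha)) * B x).
  have -> : (1 - phi x ^+ (2 * alpha)) * B x = derive1 phi x ^+ 2 / phi x ^+ 2.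
    by rewrite sqE; field; rewrite p0.
  by rewrite /rho; field; rewrite p0 lt_eqF ?phi_decr.
apply: ler_pM => //; first by rewrite divr_ge0// sqr_ge0.
  by rewrite divr_ge0// ltW.
have -> : K ^+ 2 / 4 = (K / 2) ^+ 2 by field.
by rewrite ler_sqr ?nnegrE// ?(le_trans _ rho1)// divr_ge0// ltW.
Unshelve. all: by end_near. Qed.


End Growth.

(** * Asymptotics and kernel of the profile *)

Section ProfileWave.
Context {R : realType} (alpha : nat) (a b : R).
Hypothesis halpha : (1 <= alpha)%N.
Hypothesis hb : 0 < (alpha%:R + 1) * b.
Hypothesis hab : (alpha%:R + 1) * b < a.
Implicit Types (x : R).

Local Notation r := (coupling alpha a b).
Local Notation k := (rate alpha b).
Local Notation U := (profile_base alpha a b).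
Local Notation S := (profile_base' alpha a b).
Local Notation phi := (profile alpha a b).
Local Notation s := (- (2 * alpha%:R)^-1 : R).

Let b0 : 0 < b. Proof. exact: b_gt0 hb. Qed.
Let k0 : 0 < k. Proof. exact: rate_gt0 halpha hb. Qed.
Let r1 : 1 < r. Proof. exact: coupling_gt1 hb hab. Qed.
Let U_gt0 x : 0 < U x. Proof. exact: profile_base_gt0 hb hab x. Qed.

Lemma expRN_rate_cvg0 (l : R) : 0 < l -> expR (- (l * x)) @[x --> +oo] --> (0 : R).
Proof.
move=> l0; apply: (cvg_comp (fun x : R => l * x) (fun y : R => expR (- y))).
  by apply: gt0_cvgMry => //; exact: cvg_id.
exact: cvgr_expR.
Qed.

Lemma profile_base_asymptotic :
  U x * expR (- (k * x)) @[x --> +oo] --> (r - 1) / 4.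
Proof.
have -> : (fun x => U x * expR (- (k * x))) = fun x =>
    2^-1 * (r + 1) * expR (- (k * x))
    + (r - 1) / 4 * (1 + expR (- (k * x)) * expR (- (k * x))).
  rewrite funeqE => x; rewrite /profile_base /cosh expRN.
  have := expR_gt0 (k * x); move: (expR _) => e e0.
  by field; rewrite gt_eqF.
set F := (X in X @ _ --> _).
have -> : (r - 1) / 4 = 2^-1 * (r + 1) * 0 + (r - 1) / 4 * (1 + 0 * 0) by ring.
have e0 := expRN_rate_cvg0 k0.
apply: cvgD; first by apply: cvgM => //; exact: cvg_cst.
apply: cvgM; first exact: cvg_cst.
by apply: cvgD; [exact: cvg_cst|apply: cvgM].
Qed.

(** [U] grows like [expR (k * x)] with [k = 2 alpha sqrt b]; the power [s] turns this
   rate into [- sqrt b]. *)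
Lemma profile_factor x :
  phi x = (U x * expR (- (k * x))) `^ s * expR (- (Num.sqrt b * x)).
Proof.
have -> : expR (- (Num.sqrt b * x)) = expR (k * x) `^ s.
  rewrite -expRM; congr expR; rewrite /rate; field.
  by rewrite gt_eqF ?alpha_gt0.
rewrite -powRM ?expR_ge0 ?mulr_ge0 ?expR_ge0//; last exact: ltW.
by rewrite -mulrA -expRD addNr expR0 mulr1.
Qed.

Lemma profile_asymptotic : exists C : R, 0 < C /\
  phi x / (C * expR (- (Num.sqrt b * x))) @[x --> +oo] --> (1 : R).
Proof.
have q0 : 0 < (r - 1) / 4 by rewrite divr_gt0// subr_gt0.
exists (((r - 1) / 4) `^ s); split; first exact: powR_gt0.
have C0 : ((r - 1) / 4) `^ s != 0 by rewrite gt_eqF ?powR_gt0.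
have -> : (fun x => phi x / (((r - 1) / 4) `^ s * expR (- (Num.sqrt b * x)))) =
    fun x => (U x * expR (- (k * x))) `^ s * (((r - 1) / 4) `^ s)^-1.
  rewrite funeqE => x.
  by rewrite profile_factor -mulf_div mulfV ?mulr1// gt_eqF ?expR_gt0.
rewrite -[X in _ `=>` nbhs X](mulfV C0); apply: cvgM; last exact: cvg_cst.
have cp : {for (r - 1) / 4, continuous (fun y : R => y `^ s)}.
  apply: differentiable_continuous; apply/derivable1_diffP.
  by case: (is_derive1_powR s q0).
by apply: (cvg_comp _ (fun y : R => y `^ s)) cp; exact: profile_base_asymptotic.
Qed.

Lemma profile_vanishes : vanishes_at_infinity phi.
Proof.
have H : phi x @[x --> +oo] --> (0 : R).
  have [C [C0 hC]] := profile_asymptotic.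
  have -> : phi = fun x => phi x / (C * expR (- (Num.sqrt b * x)))
      * (C * expR (- (Num.sqrt b * x))).
    by rewrite funeqE => x; rewrite divfK// mulf_neq0// gt_eqF ?expR_gt0.
  have -> : nbhs (0 : R) = nbhs (1 * (C * 0) : R) by rewrite mul1r mulr0.
  apply: cvgM => //; apply: cvgM; first exact: cvg_cst.
  by apply: expRN_rate_cvg0; rewrite sqrtr_gt0.
split => //; apply/cvgNy_compNP; apply: cvg_trans H.
by apply: near_eq_cvg; apply: nearW => x /=; rewrite -profile_even.
Qed.

Lemma profile_in01 x : 0 < phi x < 1.
Proof. by rewrite (profile_gt0 hb hab) (profile_lt1 halpha hb hab). Qed.

Lemma profile_pow2a_neq1 x : phi x ^+ (2 * alpha) != 1.
Proof.
have /andP[p0 p1] := profile_in01 x.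
by rewrite lt_eqF// pow2a_lt1// ltW.
Qed.

Lemma profile_solitary_wave : solitary_wave alpha a b phi.
Proof.
split; [|exact: profile_in01|exact: profile_vanishes].
exact: (system_classical_solution halpha profile_pow2a_neq1 (profile_system halpha hb hab)).
Qed.

Lemma derive1_profileE :
  derive1 phi = fun x => s * phi x * S x / U x.
Proof.
rewrite funeqE => x; exact: has_deriv_derive1 (has_deriv_profile hb hab x).
Qed.

Lemma derive1_profile_odd x : derive1 phi (- x) = - derive1 phi x.
Proof.
rewrite derive1_profileE -profile_even.
have -> : U (- x) = U x.
  by rewrite /profile_base /cosh mulrN opprK (addrC (expR (- _))).
have -> : S (- x) = - S x.
  by rewrite /profile_base' mulrN opprK; ring.
by rewrite mulrN mulNr.
Qed.

Lemma derive1_profile_neq0 x : x != 0 -> derive1 phi x != 0.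
Proof.
have [x0|x0|->] := ltgtP x 0 => //.
- move=> _; rewrite -[x]opprK derive1_profile_odd oppr_eq0 lt_eqF//.
  by apply: profile_decr; rewrite ?oppr_gt0.
- by move=> _; rewrite lt_eqF//; apply: profile_decr.
Qed.

Lemma derive1_profile0 : derive1 phi 0 = 0.
Proof.
by rewrite derive1_profileE /profile_base' mulr0 oppr0 subrr mul0r !(mulr0, mul0r).
Qed.

(** [phi'] vanishes only at the origin, where [chi = 0] and the system gives
   [chi' = - alpha b phi]. *)
Lemma tangent_neq0 x :
  derive1 phi x != 0 \/ derive1 (profile_chi alpha a b) x != 0.
Proof.
have [->|x0] := eqVneq x 0; last by left; exact: derive1_profile_neq0.
right; have [_ hc] := profile_system halpha hb hab.
rewrite (has_deriv_derive1 (hc 0)).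
have -> : profile_chi alpha a b 0 = 0.
  by rewrite /profile_chi /profile_base' mulr0 oppr0 subrr mul0r !(mulr0, mul0r).
have p0 := profile_gt0 hb hab 0; have al0 := alpha_gt0 (R := R) halpha.
have U0 : U 0 = r.
  by rewrite /profile_base /cosh mulr0 oppr0 expR0; field.
rewrite expr0n mulr0 mul0r addn1 exprS (profile_pow2a halpha hb hab) U0.
have -> : 0 - a * (phi 0 / r) + b * phi 0 = - (alpha%:R * b * phi 0).
  rewrite /coupling; field; rewrite !gt_eqF ?alpha1_gt0//.
  by rewrite (lt_trans hb).
by rewrite oppr_eq0 gt_eqF// mulr_gt0 ?p0// mulr_gt0.
Qed.

Lemma derive1_profile_L2 : derive1 phi \in Lfun (@lebesgue_measure R) 2%:E.
Proof.
have Sys := profile_system halpha hb hab.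
have [hd _] := tangent_linear_system halpha Sys.
have d0 x : 0 <= x -> derive1 phi x <= 0.
  rewrite le_eqVlt => /predU1P[<-|x0]; first by rewrite derive1_profile0.
  by apply/ltW/profile_decr.
have hd1 x := has_deriv_self (has_deriv_profile hb hab x).
have a0 : 0 <= a by rewrite ltW// (lt_trans hb).
have ge := derive1_ge halpha Sys profile_in01 profile_vanishes a0 b0.
exact: (L2_derivative hd1 (has_deriv_continuous hd) d0 ge derive1_profile_odd
  profile_vanishes.1).
Qed.

(** A kernel element whose Wronskian with [phi'] is nonzero would be bounded away
   from 0 near [+oo]; a negative Wronskian is reduced to a positive one by changing the
   sign of [v]. *)
Lemma kernel_profile :
  ker_linearized alpha a b phi = span1 (derive1 phi).
Proof.
have Sys := profile_system halpha hb hab.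
have T := tangent_linear_system halpha Sys.
apply/seteqP; split => v /=.
  move=> [v2 cv cdv Lv].
  have L := linearized_system Sys profile_pow2a_neq1 cv cdv Lv.
  set e := dchi alpha phi v in L.
  pose w := derive1 phi 0 * e 0 - v 0 * derive1 (profile_chi alpha a b) 0.
  have a0 : 0 <= a by rewrite ltW// (lt_trans hb).
  have gr := positive_wronskian_growth halpha Sys profile_in01 profile_vanishes a0 b0
               (profile_decr halpha hb hab).
  have [wlt|wgt|w0] := ltgtP w 0.
  - have [|d d0 hd] := gr _ _ (linear_systemN L).
      by move: wlt; rewrite /w; nra.
    apply: False_ind; apply: (not_L2_of_lower_bound d0 _ v2).
    by apply: filterS hd => x; rewrite sqrrN.
  - have [d d0 hd] := gr _ _ L wgt.
    by case: (not_L2_of_lower_bound d0 hd v2).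
  - have [q hq] := wronskian0_proportional T L tangent_neq0
      (fun x => etrans (wronskian_cst x 0 T L) w0).
    by exists q; rewrite funeqE.
move=> [q ->].
have [c1 c2 c3] := system_linearized halpha Sys profile_pow2a_neq1 (linear_systemZ q T).
split => //.
have -> : (fun x => q * derive1 phi x) = q \o* derive1 phi.
  by rewrite funeqE => x /=; rewrite mulrC.
by apply: Lfun_scale; [rewrite ler1n|exact: derive1_profile_L2].
Qed.

End ProfileWave.

Theorem theorem1 (R : realType) (alpha : nat) (a b : R)
    (halpha : (1 <= alpha)%N) :
  (* (A) *)
  (0 < a -> a <= (alpha%:R + 1) * b ->
     ~ exists phi : R -> R,
         [/\ classical_solution alpha a b phi,
             forall x, 0 <= phi x < 1,
             vanishes_at_infinity phi
           & exists x, phi x <> 0])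
  /\
  (* (B) *)
  (0 < (alpha%:R + 1) * b -> (alpha%:R + 1) * b < a ->
     let phi := profile alpha a b in
     (exists psi : R -> R, solitary_wave alpha a b psi)
     /\ (forall psi1 psi2 : R -> R,
           solitary_wave alpha a b psi1 -> solitary_wave alpha a b psi2 ->
           exists t : R, forall x, psi2 x = psi1 (x - t))
     /\ solitary_wave alpha a b phi
     /\ C1 phi
     /\ (forall x, phi x = phi (- x))
     /\ (forall x : R, 0 < x -> derive1 phi x < 0)
     /\ (exists C : R, 0 < C /\
           phi x / (C * expR (- (Num.sqrt b * x))) @[x --> +oo] --> (1 : R))
     /\ ker_linearized alpha a b phi = span1 (derive1 phi)).
Proof.
split=> [a0 ab [phi [sol phi01 phi0 [x]]]|hb hab phi].
  by apply; exact: (no_solitary_wave x halpha a0 ab sol phi01 phi0).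
have sw := profile_solitary_wave halpha hb hab.
split; first by exists phi.
split.
  move=> psi1 psi2 sw1 sw2.
  have [t1 h1] := wave_translate halpha hb sw1.
  have [t2 h2] := wave_translate halpha hb sw2.
  by exists (t2 - t1) => x; rewrite h1 h2; congr profile; ring.
split; first exact: sw.
split; first by case: sw => -[].
split; first exact: profile_even.
split; first by move=> x; exact: profile_decr.
split; first exact: profile_asymptotic.
exact: kernel_profile.
Qed.
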